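(* Let $(T_1,\dots,T_k)$ be a tuple of contractions on a Hilbert space $\mathcal{H}$ and $q_{ij}\in\mathbb{T}$ ($1\le i<j\le k$) such that $T_iT_j=q_{ij}T_jT_i$ and $T_iT_j^*=\overline{q_{ij}}\,T_j^*T_i$ for $1\le i<j\le k$. Then there exist a Hilbert space $\mathcal{K}\supseteq\mathcal{H}$, a commuting family $\{Q_{ij}:1\le i<j\le k\}$ of unitaries on $\mathcal{K}$ and unitaries $U_1,\dots,U_k$ on $\mathcal{K}$ with $U_iU_j=Q_{ij}U_jU_i$ for $i<j$ and $Q_{ij}U_m=U_mQ_{ij}$ for all $i<j$ and all $m$, such that \[ T_1(m_1)\cdots T_k(m_k)=P_{\mathcal{H}}U_1^{m_1}\cdots U_k^{m_k}|_{\mathcal{H}} \] for all $m_1,\dots,m_k\in\mathbb{Z}$. Moreover, the $Q_{ij}$ can be chosen of the form $Q_{ij}=q_{ij}I\oplus\widetilde{Q}_{ij}$ with respect to $\mathcal{K}=\mathcal{H}\oplus\mathcal{H}^\perp$, for some unitaries $\widetilde{Q}_{ij}$ on $\mathcal{H}^\perp$.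
   Context: For a contraction $C$ and $m\in\mathbb{Z}$: $C(m)=C^m$ if $m\ge1$, $C(0)=I$, and $C(m)=(C^* )^{|m|}$ if $m<0$. $P_{\mathcal{H}}$ denotes the orthogonal projection of $\mathcal{K}$ onto $\mathcal{H}$. *)

(* Defs.v *)
From HB Require Import structures.
From mathcomp Require Import all_boot all_order all_algebra.
From mathcomp Require Import complex.
From mathcomp Require Import reals.
Set Implicit Arguments. Unset Strict Implicit. Unset Printing Implicit Defensive.
Import Order.TTheory GRing.Theory Num.Theory.
Local Open Scope ring_scope.
Local Open Scope complex_scope.

Record hilbertSpace (R : realType) := HilbertSpace {
  hs_car :> lmodType R[i];
  hs_inner : hs_car -> hs_car -> R[i];
  hs_linl : forall (a : R[i]) (x y z : hs_car),
      hs_inner (a *: x + y) z = a * hs_inner x z + hs_inner y z;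
  hs_sym : forall x y : hs_car, hs_inner x y = (hs_inner y x)^*;
  hs_pos : forall x : hs_car, 0 <= hs_inner x x;
  hs_def : forall x : hs_car, hs_inner x x = 0 -> x = 0;
  hs_complete : forall u : nat -> hs_car,
      (forall e : R, 0 < e -> exists N : nat, forall m n : nat,
          (N <= m)%N -> (N <= n)%N -> hs_inner (u m - u n) (u m - u n) < e%:C) ->
      exists l : hs_car, forall e : R, 0 < e -> exists N : nat, forall n : nat,
          (N <= n)%N -> hs_inner (u n - l) (u n - l) < e%:C
}.

Arguments hs_inner {R} _ _ _.
Section Ops.
Variables (R : realType) (H : hilbertSpace R).

Definition lin_op (T : H -> H) : Prop :=
  forall (a : R[i]) (x y : H), T (a *: x + y) = a *: T x + T y.

Definition is_adjoint (T S : H -> H) : Prop :=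
  forall x y : H, hs_inner H (T x) y = hs_inner H x (S y).

Definition contraction (T : H -> H) : Prop :=
  lin_op T /\ forall x : H, hs_inner H (T x) (T x) <= hs_inner H x x.

Definition unitary (U Uinv : H -> H) : Prop :=
  [/\ lin_op U, (forall x y : H, hs_inner H (U x) (U y) = hs_inner H x y),
      cancel U Uinv & cancel Uinv U].

(* f(m) := f^m for m >= 0, g^|m| for m < 0 (g the adjoint / inverse) *)
Definition zpow (f g : H -> H) (m : int) : H -> H :=
  match m with
  | Posz n => iter n f
  | Negz n => iter n.+1 g
  end.

Definition zprod (k : nat) (f g : 'I_k -> H -> H) (m : 'I_k -> int) : H -> H :=
  foldr (fun i acc => zpow (f i) (g i) (m i) \o acc) id (enum 'I_k).

End Ops.

(* V : H -> K is a linear isometric embedding (identifies H with a closed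
   subspace of K) *)
Definition isometric_embedding (R : realType) (H K : hilbertSpace R) (V : H -> K) :=
  (forall (a : R[i]) (x y : H), V (a *: x + y) = a *: V x + V y) /\
  (forall x y : H, hs_inner K (V x) (V y) = hs_inner H x y).

(* P_H z = V w : V w is the orthogonal projection of z onto the range V(H) *)
Definition proj_eq (R : realType) (H K : hilbertSpace R) (V : H -> K) (z : K) (w : H) :=
  forall y : H, hs_inner K (z - V w) (V y) = 0.

(* Main.v *)
(* The dilation constructed has [Q i j = q i j I] on all of [K]: the operators are made
   unitary one at a time.  To dilate [A = T p] with adjoint [As], use the Schaeffer unitary
   on l2(Z, H), with central block [A Ds; D -As], where [D] and [Ds] are the square roots of
   [I - As A] and [I - A As], and replace each other [T a] by the diagonal operator with
   entries [w a z T a], where the weights [w a z] are the powers of [c p a] that make the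
   shift part of the Schaeffer matrix q-commute with it.  The centre works because [T a]
   commutes with [As A] and [A As], hence with [D] and [Ds].  The relation with the adjoints
   is free once [A] has become unitary.  The copy of [H] at position 0 reduces all the
   diagonal operators, so the compression of any product of powers is unchanged.  The square
   roots come from the limits of [X 0 = 0], [X n.+1 = (B + X n ^ 2) / 2], whose increments are
   dominated by those of the scalar iteration with [B = 1]. *)
From mathcomp Require Import ring lra.
From mathcomp Require Import all_classical topology normedtype sequences.
Require Import Defs.
From HB Require Import structures.
From mathcomp Require Import all_boot all_order all_algebra.
From mathcomp Require Import complex.
From mathcomp Require Import reals.
Set Implicit Arguments. Unset Strict Implicit. Unset Printing Implicit Defensive.
Import Order.TTheory GRing.Theory Num.Theory.
Import numFieldNormedType.Exports.
Local Open Scope ring_scope.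
Local Open Scope complex_scope.

Local Notation Re := complex.Re.
Local Notation Im := complex.Im.

(** * Real and imaginary parts, conjugation, unimodular numbers *)

Section ComplexParts.
Variable R : realType.
Implicit Types x y : R[i].

Lemma ReD x y : Re (x + y) = Re x + Re y. Proof. by case: x; case: y. Qed.
Lemma ImD x y : Im (x + y) = Im x + Im y. Proof. by case: x; case: y. Qed.
Lemma ReN x : Re (- x) = - Re x. Proof. by case: x. Qed.
Lemma ReM x y : Re (x * y) = Re x * Re y - Im x * Im y.
Proof. by case: x; case: y. Qed.
Lemma ImM x y : Im (x * y) = Re x * Im y + Im x * Re y.
Proof. by case: x => a b; case: y => c d /=; ring. Qed.
Lemma ReJ x : Re (conjc x) = Re x. Proof. by case: x. Qed.
Lemma ImJ x : Im (conjc x) = - Im x. Proof. by case: x. Qed.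
Lemma complex_ext x y : Re x = Re y -> Im x = Im y -> x = y.
Proof. by case: x => a b; case: y => c d /= -> ->. Qed.

Lemma conjcD x y : conjc (x + y) = conjc x + conjc y. Proof. exact: rmorphD. Qed.
Lemma conjcM x y : conjc (x * y) = conjc x * conjc y. Proof. exact: rmorphM. Qed.
Lemma conjcN x : conjc (- x) = - conjc x. Proof. exact: rmorphN. Qed.

Lemma norm1_mulJ x : `|x| = 1 -> x * conjc x = 1.
Proof.
move=> h; have := normcE x; rewrite h => /esym h1.
by rewrite -(sqr_sqrtc (x * conjc x)) h1 expr1n.
Qed.

Lemma expr_mulJ x n : x * conjc x = 1 -> x ^+ n * conjc (x ^+ n) = 1.
Proof.
move=> x1; elim: n => [|n IH]; first by rewrite expr0 mul1r conjc1.
by rewrite exprS conjcM mulrACA x1 IH mul1r.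
Qed.

End ComplexParts.

(** * Norms, Cauchy-Schwarz, adjoints and contractions *)

Section Hilbert.
Variables (R : realType) (H : hilbertSpace R).
Local Notation ip := (hs_inner H).
Implicit Types (x y z : H) (a : R[i]) (T S : H -> H).

Lemma ipDl x y z : ip (x + y) z = ip x z + ip y z.
Proof. by have := hs_linl 1 x y z; rewrite scale1r mul1r. Qed.
Lemma ip0l z : ip 0 z = 0.
Proof. by apply: (addrI (ip 0 z)); rewrite -ipDl !addr0. Qed.
Lemma ipZl a x z : ip (a *: x) z = a * ip x z.
Proof. by have := hs_linl a x 0 z; rewrite ip0l !addr0. Qed.
Lemma ipNl x z : ip (- x) z = - ip x z.
Proof. by rewrite -scaleN1r ipZl mulN1r. Qed.
Lemma ipBl x y z : ip (x - y) z = ip x z - ip y z.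
Proof. by rewrite ipDl ipNl. Qed.
Lemma ipDr x y z : ip z (x + y) = ip z x + ip z y.
Proof. by rewrite hs_sym ipDl conjcD -(hs_sym z x) -(hs_sym z y). Qed.
Lemma ip0r z : ip z 0 = 0.
Proof. by rewrite hs_sym ip0l conjc0. Qed.
Lemma ipZr a x z : ip z (a *: x) = conjc a * ip z x.
Proof. by rewrite hs_sym ipZl conjcM -(hs_sym z x). Qed.
Lemma ipNr x z : ip z (- x) = - ip z x.
Proof. by rewrite hs_sym ipNl conjcN -(hs_sym z x). Qed.
Lemma ipBr x y z : ip z (x - y) = ip z x - ip z y.
Proof. by rewrite ipDr ipNr. Qed.

Definition nsq x : R := Re (ip x x).
Definition hn x : R := Num.sqrt (nsq x).

Lemma ipxx x : ip x x = (nsq x)%:C.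
Proof.
rewrite /nsq; have := hs_pos x.
by case: (ip x x) => u v /=; rewrite lecE /= => /andP[/eqP -> _].
Qed.

Lemma nsq_ge0 x : 0 <= nsq x.
Proof. by have := hs_pos x; rewrite ipxx ler0c. Qed.

Lemma nsq_eq0 x : nsq x = 0 -> x = 0.
Proof. by move=> h; apply: hs_def; rewrite ipxx h. Qed.

Lemma nsq0 : nsq 0 = 0. Proof. by rewrite /nsq ip0l. Qed.

Lemma nsqN x : nsq (- x) = nsq x.
Proof. by rewrite /nsq ipNl ipNr opprK. Qed.

Lemma nsqZ a x : nsq (a *: x) = (Re a ^+ 2 + Im a ^+ 2) * nsq x.
Proof.
rewrite {1}/nsq ipZl ipZr ipxx; case: a => u v.
by rewrite !ReM !ImM /=; ring.
Qed.

Lemma nsqZ1 a x : a * conjc a = 1 -> nsq (a *: x) = nsq x.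
Proof.
by move=> h; rewrite /nsq ipZl ipZr mulrA h mul1r.
Qed.

Lemma nsqZr (r : R) x : nsq (r%:C *: x) = r ^+ 2 * nsq x.
Proof. by rewrite nsqZ /= expr0n /= addr0. Qed.

Lemma nsqD x y : nsq (x + y) = nsq x + nsq y + 2 * Re (ip x y).
Proof.
rewrite /nsq ipDl !ipDr !ReD (hs_sym y x) ReJ; ring.
Qed.

Lemma nsqB x y : nsq (x - y) = nsq x + nsq y - 2 * Re (ip x y).
Proof. by rewrite nsqD nsqN ipNr ReN; ring. Qed.

Lemma nsqD_le x y : nsq (x + y) <= 2 * nsq x + 2 * nsq y.
Proof. have := nsq_ge0 (x - y); rewrite nsqB nsqD; lra. Qed.

Lemma hn_ge0 x : 0 <= hn x. Proof. exact: sqrtr_ge0. Qed.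
Lemma sqr_hn x : hn x ^+ 2 = nsq x. Proof. by rewrite sqr_sqrtr // nsq_ge0. Qed.
Lemma hn0 : hn 0 = 0. Proof. by rewrite /hn nsq0 sqrtr0. Qed.
Lemma hn_eq0 x : hn x = 0 -> x = 0.
Proof. by move=> h; apply: nsq_eq0; rewrite -sqr_hn h expr0n. Qed.
Lemma hnN x : hn (- x) = hn x. Proof. by rewrite /hn nsqN. Qed.
Lemma hnB x y : hn (x - y) = hn (y - x). Proof. by rewrite -hnN opprB. Qed.
Lemma hnZr (r : R) x : 0 <= r -> hn (r%:C *: x) = r * hn x.
Proof. by move=> r0; rewrite /hn nsqZr sqrtrM ?sqr_ge0 // sqrtr_sqr ger0_norm. Qed.

(** Cauchy-Schwarz for the real part: expand the squared norm of [x] scaled by [hn y] minus [y]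
    scaled by [hn x], then divide by [hn x * hn y]; vanishing norms are treated apart. *)
Lemma Re_ip_le x y : Re (ip x y) <= hn x * hn y.
Proof.
have [x0|x0] := eqVneq (hn x) 0; first by rewrite (hn_eq0 x0) ip0l hn0 mul0r.
have [y0|y0] := eqVneq (hn y) 0; first by rewrite (hn_eq0 y0) ip0r hn0 mulr0.
have px : 0 < hn x by rewrite lt_def x0 hn_ge0.
have py : 0 < hn y by rewrite lt_def y0 hn_ge0.
have := nsq_ge0 ((hn y)%:C *: x - (hn x)%:C *: y).
rewrite nsqB !nsqZr -!sqr_hn ipZl ipZr !ReM !ImM /=.
rewrite oppr0 !mul0r !subr0 => h.
rewrite -(ler_pM2l (mulr_gt0 px py)); move: h.
set r := Re _; set u := hn x; set v := hn y => h.
by rewrite -subr_ge0; move: h; lra.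
Qed.

Lemma hnD x y : hn (x + y) <= hn x + hn y.
Proof.
rewrite -(ler_pXn2r (n := 2)) ?nnegrE ?hn_ge0 ?addr_ge0 ?hn_ge0 //.
rewrite sqr_hn nsqD -!sqr_hn sqrrD.
by have := Re_ip_le x y; lra.
Qed.

Lemma ip_ext x y : (forall z, ip x z = ip y z) -> x = y.
Proof.
move=> h; apply/eqP; rewrite -subr_eq0; apply/eqP/hs_def.
by rewrite ipBl h subrr.
Qed.

Section Linear.
Variable T : H -> H.
Hypothesis linT : lin_op T.
Lemma linD x y : T (x + y) = T x + T y.
Proof. by have := linT 1 x y; rewrite !scale1r. Qed.
Lemma lin0 : T 0 = 0.
Proof. by apply: (addrI (T 0)); rewrite -linD !addr0. Qed.
Lemma linZ a x : T (a *: x) = a *: T x.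
Proof. by have := linT a x 0; rewrite lin0 !addr0. Qed.
Lemma linN x : T (- x) = - T x.
Proof. by rewrite -scaleN1r linZ scaleN1r. Qed.
Lemma linB x y : T (x - y) = T x - T y.
Proof. by rewrite linD linN. Qed.
End Linear.

Lemma contraction_nsq T x : contraction T -> nsq (T x) <= nsq x.
Proof. by case=> _ /(_ x); rewrite !ipxx lecR. Qed.

Lemma contraction_hn T x : contraction T -> hn (T x) <= hn x.
Proof. by move=> cT; apply/ler_wsqrtr/contraction_nsq. Qed.

Lemma adjoint_sym T S : is_adjoint T S -> is_adjoint S T.
Proof. by move=> h x y; rewrite hs_sym -h -hs_sym. Qed.

Lemma adjoint_lin T S : is_adjoint T S -> lin_op T.
Proof. by move=> h a x y; apply: ip_ext => z; rewrite hs_linl !h hs_linl. Qed.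

(** Expanding the squared norm of [T (S x) - x] gives [2 * nsq (S x) <= nsq (T (S x)) + nsq x], and
    [nsq (T (S x)) <= nsq (S x)]. *)
Lemma adjoint_contraction T S :
  is_adjoint T S -> contraction T -> contraction S.
Proof.
move=> h cT; split; first exact: adjoint_lin (adjoint_sym h).
move=> x; rewrite !ipxx lecR.
have h1 : Re (ip (T (S x)) x) = nsq (S x) by rewrite h.
have := nsq_ge0 (T (S x) - x); rewrite nsqB h1.
by have := contraction_nsq (S x) cT; lra.
Qed.

Lemma iter_adj T S n : is_adjoint T S -> is_adjoint (iter n T) (iter n S).
Proof. by move=> aT; elim: n => [|n IH] x y //=; rewrite aT IH -iterSr. Qed.

Lemma contraction_comp T S : contraction T -> contraction S -> contraction (T \o S).
Proof.
move=> [lT cT] [lS cS]; split=> [a x y|x] /=; first by rewrite lS lT.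
by apply: le_trans (cT _) (cS _).
Qed.

End Hilbert.

(** * Norm limits of sequences of vectors *)

Section StrongLimits.
Variables (R : realType) (H : hilbertSpace R).
Local Notation ip := (hs_inner H).
Implicit Types (x y z l : H) (u v : nat -> H) (a : R[i]).

(** Norm convergence is expressed as a limit of real numbers, so that the squeeze and sum rules for
    real sequences apply without a topology on [H]. *)
Definition hlim u l : Prop := ((hn (u n - l) @[n --> \oo]) --> (0 : R))%classic.

Lemma hlim_dom u l (c : nat -> R) :
  (c n @[n --> \oo] --> (0 : R))%classic ->
  (forall n, hn (u n - l) <= c n) -> hlim u l.
Proof.
move=> c0 h; apply: (squeeze_cvgr _ (cvg_cst (0 : R)) c0).
by apply: nearW => n; rewrite hn_ge0 h.
Qed.

Lemma hlimD u v l m : hlim u l -> hlim v m -> hlim (fun n => u n + v n) (l + m).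
Proof.
move=> ul vm; pose proof (cvgD ul vm) as h; rewrite addr0 in h.
refine (hlim_dom h _) => n.
by rewrite opprD addrACA hnD.
Qed.

Lemma hlimZ a u l : hlim u l -> hlim (fun n => a *: u n) (a *: l).
Proof.
move=> ul.
pose proof (cvgMl_tmp (a := Num.sqrt (Re a ^+ 2 + Im a ^+ 2)) ul) as h.
rewrite mulr0 in h; refine (hlim_dom h _) => n.
by rewrite -scalerBr /hn nsqZ sqrtrM // addr_ge0 ?sqr_ge0.
Qed.

Lemma hlim_cst l : hlim (fun=> l) l.
Proof. by rewrite /hlim subrr hn0; exact: cvg_cst. Qed.

Lemma hlim_unique u l m : hlim u l -> hlim u m -> l = m.
Proof.
move=> ul um; apply/eqP; rewrite -subr_eq0; apply/eqP/hn_eq0.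
apply: (cvg_unique (@norm_hausdorff _ _) (F := (hn (l - m) @[_ --> \oo])%classic)).
  exact: cvg_cst.
pose proof (cvgD ul um) as h; rewrite addr0 in h.
apply: (squeeze_cvgr _ (cvg_cst (0 : R)) h).
apply: nearW => n; rewrite hn_ge0.
rewrite -[X in _ <= X]/(hn (u n - l) + hn (u n - m)) (hnB (u n) l) -[l - m](subrKA (u n)).
exact: hnD.
Qed.

Lemma hlim_contraction T u l : contraction T -> hlim u l -> hlim (fun n => T (u n)) (T l).
Proof.
move=> cT ul; refine (hlim_dom ul _) => n.
by rewrite -(linB cT.1) contraction_hn.
Qed.

(** Cauchy-Schwarz bounds the difference by [hn (u n - l) * hn z]; the lower bound is the same
    inequality for the opposite vector. *)
Lemma hlim_Re_ip u l z :
  hlim u l -> (Re (ip (u n) z) @[n --> \oo] --> Re (ip l z))%classic.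
Proof.
move=> ul; pose proof (cvgMr_tmp (b := hn z) ul) as h; rewrite mul0r in h.
apply: (@cvg_sub0 _ R^o _ _ _ _ (fun=> Re (ip l z))); last exact: cvg_cst.
apply/norm_cvg0P; apply: (squeeze_cvgr _ (cvg_cst (0 : R)) h).
apply: nearW => n; rewrite normr_ge0 andTb.
change (`|Re (ip (u n) z) - Re (ip l z)| <= hn (u n - l) * hn z).
rewrite -ReN -ReD -ipBl ler_norml Re_ip_le.
by rewrite andbT lerNl -ReN -ipNl (le_trans (Re_ip_le _ _)) // hnN.
Qed.

(** Being monotone and bounded, [b] converges; its increments dominate those of [u], so [u] is
    Cauchy and completeness applies. *)
Lemma hlim_dominated_cauchy u (b : nat -> R) (C : R) :
  {homo b : m n / (m <= n)%N >-> m <= n} -> (forall n, b n <= C) ->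
  (forall m n, (m <= n)%N -> hn (u n - u m) <= b n - b m) ->
  exists l, hlim u l.
Proof.
move=> bmon bC ub.
have bcv : cvgn b.
  apply: nondecreasing_is_cvgn => //; exists C => _ [n _ <-]; exact: bC.
have bl n : b n <= limn b by apply: nondecreasing_cvgn_le.
(* Adding the tails of [b] at both indices gives a bound symmetric in [m] and [n]. *)
have key m n : hn (u n - u m) <= (limn b - b m) + (limn b - b n).
  have [mn|/ltnW nm] := leqP m n.
    by apply: le_trans (ub _ _ mn) _; have := bl n; lra.
  by rewrite hnB; apply: le_trans (ub _ _ nm) _; have := bl m; lra.
have small (e : R) : 0 < e -> exists N, forall n, (N <= n)%N -> limn b - b n < e.
  move=> e0; have /cvgrPdist_lt /(_ e e0) [N _ hN] := bcv.
  exists N => n /hN /=; exact: le_lt_trans (ler_norm _).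
have [e e0|l hl] := @hs_complete _ H u.
  (* Completeness is stated with squared norms, so each of the two tails has to stay below half the
     square root of [e]. *)
  have [|N hN] := small (Num.sqrt e / 2); first by rewrite divr_gt0 ?sqrtr_gt0.
  exists N => m n Nm Nn; rewrite ipxx ltcR -sqr_hn.
  rewrite -(sqr_sqrtr (ltW e0)) ltr_pXn2r ?nnegrE ?hn_ge0 ?sqrtr_ge0 //.
  apply: le_lt_trans (key _ _) _.
  by have := hN _ Nm; have := hN _ Nn; lra.
exists l; apply/cvgrPdist_lt => e e0.
have [N hN] := hl (e ^+ 2) (exprn_gt0 _ e0).
exists N => // n /= /hN; rewrite ipxx ltcR -sqr_hn.
rewrite ltr_pXn2r ?nnegrE ?hn_ge0 ?ltW // sub0r normrN ger0_norm ?hn_ge0 //.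
Qed.

End StrongLimits.

(** * The square root iteration and its scalar majorant *)

Section DefectSqrt.
Variable R : realType.

(** Since this sequence increases and stays below 1, its increments are summable; this gives
    convergence of the operator iterates even when [B] has norm 1. *)
Fixpoint root_bound (n : nat) : R :=
  if n is m.+1 then (1 + root_bound m ^+ 2) / 2 else 0.

Lemma root_bound01 n : 0 <= root_bound n <= 1.
Proof. by elim: n => [|n /andP[h0 h1]] /=; [lra | apply/andP; split; nra]. Qed.

Lemma root_bound_mono : {homo root_bound : m n / (m <= n)%N >-> m <= n}.
Proof.
apply: homo_leq => [x //|y x z|n]; first exact: le_trans.
by have /andP[h0 h1] := root_bound01 n; rewrite /=; nra.
Qed.

Variable H : hilbertSpace R.
Local Notation ip := (hs_inner H).
Implicit Types (x y z : H) (B C : H -> H).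

(** A limit [X] satisfies [2 X = B + X^2], that is [(I - X)^2 = I - B]. *)
Fixpoint root_iter B (n : nat) (x : H) : H :=
  if n is m.+1 then (2^-1 : R)%:C *: (B x + root_iter B m (root_iter B m x)) else 0.

Lemma root_iter_lin B n : lin_op B -> lin_op (root_iter B n).
Proof.
move=> lB; elim: n => [|n lX] a x y /=; first by rewrite scaler0 addr0.
rewrite lB !lX !scalerDr !scalerA (mulrC a); rewrite -!addrA; congr (_ + _).
by rewrite addrCA.
Qed.

Lemma root_iter_adj B n : is_adjoint B B -> is_adjoint (root_iter B n) (root_iter B n).
Proof.
move=> aB; elim: n => [|n aX] x y /=; first by rewrite ip0l ip0r.
by rewrite ipZl ipZr ipDl ipDr aB !aX conjc_real.
Qed.

Lemma root_iter_hn B n x : contraction B -> hn (root_iter B n x) <= root_bound n * hn x.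
Proof.
move=> cB; elim: n x => [|n IH] x /=; first by rewrite hn0 mul0r.
rewrite hnZr; last lra.
have := hnD (B x) (root_iter B n (root_iter B n x)).
have := contraction_hn x cB; have h1 := IH (root_iter B n x); have h2 := IH x.
have /andP[h0 _] := root_bound01 n.
by have := ler_wpM2l h0 h2; rewrite expr2; lra.
Qed.

(** With [X n] the iterates and [b n] the scalar bounds, the difference of the squares of [X n.+1]
    and [X n] is [X n.+1 (X n.+1 - X n) + (X n.+1 - X n) X n]. The bounds [b n.+1 (b n.+1 - b n)]
    and [(b n.+1 - b n) b n] of the two terms add up to the difference of the squares of [b n.+1]
    and [b n]. *)
Lemma root_iter_step B n x : contraction B ->
  hn (root_iter B n.+1 x - root_iter B n x) <= (root_bound n.+1 - root_bound n) * hn x.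
Proof.
move=> cB; elim: n x => [|n IH] x.
  have -> : root_iter B 1 x - root_iter B 0 x = (2^-1 : R)%:C *: B x.
    by rewrite /= addr0 subr0.
  rewrite hnZr /=; last lra.
  by have := contraction_hn x cB; lra.
have -> : root_iter B n.+2 x - root_iter B n.+1 x = (2^-1 : R)%:C *:
    (root_iter B n.+1 (root_iter B n.+1 x - root_iter B n x) +
     (root_iter B n.+1 (root_iter B n x) - root_iter B n (root_iter B n x))).
  rewrite (linB (root_iter_lin n.+1 cB.1)) subrKA.
  have e m : root_iter B m.+1 x = (2^-1 : R)%:C *: (B x + root_iter B m (root_iter B m x)) by [].
  by rewrite (e n.+1) (e n) -scalerBr opprD addrACA subrr add0r.
rewrite hnZr; last lra.
set u := root_iter B n.+1 _; set v := _ - root_iter B n (root_iter B n x).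
have uv := hnD u v.
have u1 : hn u <= _ := root_iter_hn n.+1 _ cB.
have v1 : hn v <= _ := IH (root_iter B n x).
have h1 := IH x; have h2 := root_iter_hn n x cB.
have /andP[h0 _] := root_bound01 n.+1.
have d0 : 0 <= root_bound n.+1 - root_bound n by rewrite subr_ge0 root_bound_mono.
have u2 := ler_wpM2l h0 h1; have v2 := ler_wpM2l d0 h2.
have -> : root_bound n.+2 - root_bound n.+1 =
    (root_bound n.+1 ^+ 2 - root_bound n ^+ 2) / 2.
  have -> : root_bound n.+2 = (1 + root_bound n.+1 ^+ 2) / 2 by [].
  have : root_bound n.+1 = (1 + root_bound n ^+ 2) / 2 by [].
  by lra.
have le := le_trans uv (lerD (le_trans u1 u2) (le_trans v1 v2)).
have := le; lra.
Qed.

End DefectSqrt.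

(** * The limit of the iteration and the defect operator *)

Section DefectOperator.
Variables (R : realType) (H : hilbertSpace R).
Local Notation ip := (hs_inner H).
Implicit Types (x y z : H) (B C : H -> H).

Lemma root_iter_cauchy B m n x : contraction B -> (m <= n)%N ->
  hn (root_iter B n x - root_iter B m x) <= (root_bound R n - root_bound R m) * hn x.
Proof.
move=> cB /subnK <-; elim: (n - m)%N => [|d IH].
  by rewrite add0n !subrr hn0 mul0r.
rewrite addSn -(subrKA (root_iter B (d + m) x)).
apply: le_trans (hnD _ _) _.
have := root_iter_step (d + m) x cB; move: IH; lra.
Qed.

Lemma root_iter_cvg B x : contraction B -> exists l, hlim (root_iter B ^~ x) l.
Proof.
move=> cB; apply: (@hlim_dominated_cauchy _ _ _ (fun n => root_bound R n * hn x) (hn x)).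
- by move=> m n mn; rewrite ler_wpM2r ?hn_ge0 ?root_bound_mono.
- by move=> n; rewrite ler_piMl ?hn_ge0 //; have /andP[] := root_bound01 R n.
- by move=> m n mn; rewrite -mulrBl root_iter_cauchy.
Qed.

(** The default value 0 is taken only when the iterates diverge, which cannot happen for a
    contraction [B]. *)
Definition root_lim B x : H := xget 0 [set l | hlim (root_iter B ^~ x) l]%classic.

Lemma root_limP B x : contraction B -> hlim (root_iter B ^~ x) (root_lim B x).
Proof.
move=> cB; rewrite /root_lim; case: xgetP => [y -> //|no].
by have [l hl] := root_iter_cvg x cB; case: (no l).
Qed.

(* The square root of [I - B]. *)
Definition defect B x : H := x - root_lim B x.

Section Contraction.
Variable B : H -> H.
Hypotheses (cB : contraction B) (aB : is_adjoint B B).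

Lemma root_lim_lin : lin_op (root_lim B).
Proof.
move=> a x y; apply: (hlim_unique (root_limP _ cB)).
have h := hlimD (hlimZ a (root_limP x cB)) (root_limP y cB).
congr (hlim _ _): h; apply: funext => n; by rewrite (root_iter_lin n cB.1).
Qed.

Lemma root_iter_contraction n : contraction (root_iter B n).
Proof.
split=> [|x]; first exact: root_iter_lin cB.1.
rewrite !ipxx lecR -!sqr_hn ler_pXn2r ?nnegrE ?hn_ge0 //.
apply: le_trans (root_iter_hn _ _ cB) _.
by rewrite ler_piMl ?hn_ge0 //; have /andP[] := root_bound01 R n.
Qed.

(** The imaginary part of [ip u v] is the real part of [ip u (i v)], so real parts suffice; the
    limit rule for inner products is stated for real parts. *)
Lemma Re_adjoint (T S : H -> H) : lin_op T -> lin_op S ->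
  (forall x y, Re (ip (T x) y) = Re (ip x (S y))) -> is_adjoint T S.
Proof.
move=> lT lS h x y; apply: complex_ext => //.
have im u v : Im (ip u v) = Re (ip u ('i%C *: v)).
  by rewrite ipZr ReM /=; ring.
by rewrite !im -(linZ lS) h.
Qed.

Lemma root_lim_adj : is_adjoint (root_lim B) (root_lim B).
Proof.
apply: Re_adjoint; try exact: root_lim_lin.
move=> x y.
have h1 := hlim_Re_ip (z := y) (root_limP x cB).
have h2 := hlim_Re_ip (z := x) (root_limP y cB).
have -> : Re (ip x (root_lim B y)) = Re (ip (root_lim B y) x) by rewrite hs_sym ReJ.
apply: (cvg_unique (@norm_hausdorff _ _) h1).
rewrite (_ : (fun n => Re (ip (root_iter B n y) x)) =
             (fun n => Re (ip (root_iter B n x) y))) // in h2.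
by apply: funext => n; rewrite hs_sym ReJ (root_iter_adj n aB).
Qed.

Lemma root_lim_fix x : root_lim B x + root_lim B x = B x + root_lim B (root_lim B x).
Proof.
have e : (2^-1 : R)%:C + (2^-1 : R)%:C = 1 :> R[i].
  by rewrite -rmorphD /= (_ : 2^-1 + 2^-1 = 1 :> R) //; lra.
suff r : root_lim B x = (2^-1 : R)%:C *: (B x + root_lim B (root_lim B x)).
  by rewrite {1 2}r -scalerDl e scale1r.
(* With [X n] the iterates and [X] their limit, the error is the sum of [X n (X n x - X x)], small
   because [X n] is a contraction, and of [X n (X x) - X (X x)]. *)
have xx : hlim (fun n => root_iter B n (root_iter B n x)) (root_lim B (root_lim B x)).
  have h1 := root_limP x cB; have h2 := root_limP (root_lim B x) cB.
  pose proof (cvgD h1 h2) as h; rewrite addr0 in h.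
  refine (hlim_dom h _) => n; rewrite -(subrKA (root_iter B n (root_lim B x))).
  apply: le_trans (hnD _ _) _; apply: lerD => //.
  by rewrite -(linB (root_iter_lin n cB.1)); apply/contraction_hn/root_iter_contraction.
have h := hlimZ (2^-1 : R)%:C (hlimD (hlim_cst (B x)) xx).
apply: hlim_unique h.
(* The sequence shifted by one index has the same limit and is given by the recurrence. *)
have := root_limP x cB; rewrite /hlim -(cvg_shiftS (fun n => hn _)).
by [].
Qed.

Lemma defect_lin : lin_op (defect B).
Proof. by move=> a x y; rewrite /defect root_lim_lin scalerBr opprD addrACA. Qed.

Lemma defect_adj : is_adjoint (defect B) (defect B).
Proof. by move=> x y; rewrite /defect ipBl ipBr root_lim_adj. Qed.

(** With [X] the limit, [(I - X)^2 = I - 2 X + X^2], and the fixed point equation turns this into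
    [I - B]. *)
Lemma defect_sq x : defect B (defect B x) = x - B x.
Proof.
rewrite {1}/defect; rewrite /defect (linB root_lim_lin).
have f := root_lim_fix x.
have -> : B x = root_lim B x + root_lim B x - root_lim B (root_lim B x).
  by rewrite f addrK.
by rewrite !opprD !opprK !addrA.
Qed.

End Contraction.

(** A [C] that intertwines [B] with [B'] intertwines all their iterates, and it is continuous.
    Distinct [B] and [B'] serve for [A D = Ds A]; equal ones serve for the operators commuting with
    [As A] or [A As]. *)
Lemma root_lim_comm B B' C : contraction B -> contraction B' -> contraction C ->
  (forall x, C (B x) = B' (C x)) -> forall x, C (root_lim B x) = root_lim B' (C x).
Proof.
move=> cB cB' cC h x.
apply: hlim_unique (hlim_contraction cC (root_limP x cB)) _.
have e n y : C (root_iter B n y) = root_iter B' n (C y).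
  elim: n y => [|n IH] y /=; first by rewrite (lin0 cC.1).
  by rewrite (linZ cC.1) (linD cC.1) h !IH.
have := root_limP (C x) cB'; congr (hlim _ _); apply: funext => n; by rewrite e.
Qed.

Lemma defect_comm B B' C : contraction B -> contraction B' -> contraction C ->
  (forall x, C (B x) = B' (C x)) -> forall x, C (defect B x) = defect B' (C x).
Proof. by move=> cB cB' cC h x; rewrite /defect (linB cC.1) (root_lim_comm cB cB' cC h). Qed.

End DefectOperator.

(** * Series of complex numbers *)

Section ComplexSeries.
Variable R : realType.
Implicit Types (phi psi : nat -> R[i]) (l m : R[i]).

Definition csums phi l : Prop :=
  ((\sum_(i < n) Re (phi i) @[n --> \oo] --> Re l) /\
   (\sum_(i < n) Im (phi i) @[n --> \oo] --> Im l))%classic.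

Definition csum phi : R[i] := xget 0 [set l | csums phi l]%classic.

Lemma csums_unique phi l m : csums phi l -> csums phi m -> l = m.
Proof.
move=> [rl il] [rm im]; apply: complex_ext.
  exact: (cvg_unique (@norm_hausdorff _ _) rl rm).
exact: (cvg_unique (@norm_hausdorff _ _) il im).
Qed.

Lemma csum_eq phi l : csums phi l -> csum phi = l.
Proof.
move=> h; rewrite /csum; case: xgetP => [y _ hy|no]; last by case: (no l).
exact: csums_unique hy h.
Qed.

Lemma csumP phi : (exists l, csums phi l) -> csums phi (csum phi).
Proof. by move=> [l h]; rewrite (csum_eq h). Qed.

Lemma csumsD phi psi l m : csums phi l -> csums psi m ->
  csums (fun n => phi n + psi n) (l + m).
Proof.
move=> [rl il] [rm im]; split.
  rewrite ReD (_ : (fun n => _) = fun n => \sum_(i < n) Re (phi i) + \sum_(i < n) Re (psi i)).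
    exact: cvgD.
  by apply: funext => n; rewrite -big_split; apply: eq_bigr => i _; rewrite ReD.
rewrite ImD (_ : (fun n => _) = fun n => \sum_(i < n) Im (phi i) + \sum_(i < n) Im (psi i)).
  exact: cvgD.
by apply: funext => n; rewrite -big_split; apply: eq_bigr => i _; rewrite ImD.
Qed.

Lemma csumsZ a phi l : csums phi l -> csums (fun n => a * phi n) (a * l).
Proof.
move=> [rl il]; split.
  rewrite ReM (_ : (fun n => _) = fun n =>
      Re a * \sum_(i < n) Re (phi i) - Im a * \sum_(i < n) Im (phi i)).
    by apply: cvgB; apply: cvgMl_tmp.
  by apply: funext => n; rewrite !big_distrr -sumrB; apply: eq_bigr => i _; rewrite ReM.
rewrite ImM (_ : (fun n => _) = fun n =>
    Re a * \sum_(i < n) Im (phi i) + Im a * \sum_(i < n) Re (phi i)).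
  by apply: cvgD; apply: cvgMl_tmp.
by apply: funext => n; rewrite !big_distrr -big_split; apply: eq_bigr => i _; rewrite ImM.
Qed.

Lemma csumsJ phi l : csums phi l -> csums (fun n => conjc (phi n)) (conjc l).
Proof.
move=> [rl il]; split.
  rewrite ReJ (_ : (fun n => _) = fun n => \sum_(i < n) Re (phi i)) //.
  by apply: funext => n; apply: eq_bigr => i _; rewrite ReJ.
rewrite ImJ (_ : (fun n => _) = fun n => - \sum_(i < n) Im (phi i)); first exact: cvgN.
by apply: funext => n; rewrite -sumrN; apply: eq_bigr => i _; rewrite ImJ.
Qed.

Lemma csums_recl phi l : csums (fun n => phi n.+1) l -> csums phi (phi 0 + l).
Proof.
move=> [rl il]; split.
  rewrite ReD -(cvg_shiftS (fun n => \sum_(i < n) _)) /=.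
  rewrite (_ : (fun n => _) = fun n => Re (phi 0) + \sum_(i < n) Re (phi i.+1)).
    by apply: cvgD => //; exact: cvg_cst.
  by apply: funext => n; rewrite big_ord_recl.
rewrite ImD -(cvg_shiftS (fun n => \sum_(i < n) _)) /=.
rewrite (_ : (fun n => _) = fun n => Im (phi 0) + \sum_(i < n) Im (phi i.+1)).
  by apply: cvgD => //; exact: cvg_cst.
by apply: funext => n; rewrite big_ord_recl.
Qed.

Lemma csums0 : csums (fun=> 0) 0.
Proof.
by split; rewrite (_ : (fun n => _) = fun=> 0); try exact: cvg_cst;
   apply: funext => n; rewrite big1.
Qed.

Lemma dominated_series_cvg (u b : nat -> R) (M : R) :
  (forall n, `|u n| <= b n) -> (forall n, \sum_(i < n) b i <= M) ->
  exists s : R, (\sum_(i < n) u i @[n --> \oo] --> s)%classic.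
Proof.
move=> ub bM.
have b0 n : 0 <= b n by exact: le_trans (ub n).
have cb : cvgn (series b).
  apply: nondecreasing_is_cvgn; first by move=> m n mn; exact: nondecreasing_series.
  by exists M => _ [n _ <-]; rewrite /series /= big_mkord.
have cu : cvgn (series u).
  by apply: normed_cvg; apply: series_le_cvg cb => n /=.
exists (limn (series u)).
rewrite (_ : (fun n => _) = series u); first exact: cu.
by apply: funext => n; rewrite /series /= big_mkord.
Qed.

Lemma csums_dominated phi (b : nat -> R) (M : R) :
  (forall n, `|Re (phi n)| <= b n) -> (forall n, `|Im (phi n)| <= b n) ->
  (forall n, \sum_(i < n) b i <= M) -> exists l, csums phi l.
Proof.
move=> rb ib bM.
have [u hu] := dominated_series_cvg rb bM; have [v hv] := dominated_series_cvg ib bM.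
by exists (u +i* v).
Qed.

End ComplexSeries.

(** * The Hilbert space of square-summable two-sided sequences *)

Section SquareSummable.
Variables (R : realType) (H : hilbertSpace R).
Local Notation ip := (hs_inner H).
Implicit Types f g h : int -> H.

(* The integer index [z] is split into [Posz n = n] and [Negz n = - n.+1]. *)
Definition fold_nsq f (n : nat) : R := nsq (f (Posz n)) + nsq (f (Negz n)).

Definition fold_ip f g (n : nat) : R[i] :=
  ip (f (Posz n)) (g (Posz n)) + ip (f (Negz n)) (g (Negz n)).

Definition square_summable f : Prop :=
  exists M : R, forall n, \sum_(i < n) fold_nsq f i <= M.

Lemma fold_nsq_ge0 f n : 0 <= fold_nsq f n.
Proof. by rewrite addr_ge0 ?nsq_ge0. Qed.

Lemma fold_nsqD f g n : fold_nsq (f + g) n <= 2 * fold_nsq f n + 2 * fold_nsq g n.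
Proof.
rewrite /fold_nsq.
have := nsqD_le (f (Posz n)) (g (Posz n)); have := nsqD_le (f (Negz n)) (g (Negz n)).
rewrite -[(f + g) (Posz n)]/(f (Posz n) + g (Posz n)).
rewrite -[(f + g) (Negz n)]/(f (Negz n) + g (Negz n)).
lra.
Qed.

Lemma fold_nsqB f g n :
  fold_nsq (f - g) n = nsq (f (Posz n) - g (Posz n)) + nsq (f (Negz n) - g (Negz n)).
Proof. by []. Qed.

Lemma square_summable_dom f g (C : R) : 0 <= C ->
  (forall n, fold_nsq f n <= C * fold_nsq g n) ->
  square_summable g -> square_summable f.
Proof.
move=> C0 fg [M hM]; exists (C * M) => n.
apply: le_trans (ler_wpM2l C0 (hM n)); rewrite big_distrr /=.
by apply: ler_sum => i _; exact: fg.
Qed.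

Lemma square_summable_dom1 f g :
  (forall n, fold_nsq f n <= fold_nsq g n) -> square_summable g -> square_summable f.
Proof.
move=> fg; apply: (square_summable_dom (C := 1)) => // n; by rewrite mul1r.
Qed.

Definition l2_pred : {pred int -> H} := fun f => `[< square_summable f >].

Lemma l2_submod_closed : GRing.subsemimod_closed l2_pred.
Proof.
split; first split.
- apply/asboolP; exists 0 => n; rewrite big1 // => i _.
  by rewrite /fold_nsq /= !nsq0 addr0.
- move=> f g /asboolP [M hM] /asboolP [N hN]; apply/asboolP; exists (2 * M + 2 * N) => n.
  have := lerD (ler_wpM2l (ler0n R 2) (hM n)) (ler_wpM2l (ler0n R 2) (hN n)).
  apply: le_trans; rewrite !big_distrr -big_split /=; apply: ler_sum => i _.
  exact: fold_nsqD.
move=> a f /asboolP ff; apply/asboolP.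
apply: (square_summable_dom (C := Re a ^+ 2 + Im a ^+ 2) _ _ ff) => [|n].
  by rewrite addr_ge0 ?sqr_ge0.
by rewrite /fold_nsq !nsqZ -mulrDr.
Qed.

HB.instance Definition _ := GRing.isSubmodClosed.Build _ _ l2_pred l2_submod_closed.

Record l2 := L2 { l2_val :> int -> H; l2_valP : l2_val \in l2_pred }.
HB.instance Definition _ := [isSub for l2_val].
HB.instance Definition _ := [Choice of l2 by <:].
HB.instance Definition _ := [SubChoice_isSubLmodule of l2 by <:].

Lemma l2_square_summable (f : l2) : square_summable f.
Proof. by have /asboolP := l2_valP f. Qed.

Lemma l2_ext (f g : l2) : (forall z, f z = g z) -> f = g.
Proof. by move=> fg; apply: val_inj; apply: funext. Qed.

Lemma l2_linE (a : R[i]) (f g : l2) z : (a *: f + g) z = a *: f z + g z.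
Proof. by []. Qed.

Lemma l2_subE (f g : l2) z : (f - g) z = f z - g z.
Proof. by []. Qed.

(** Positivity of [nsq (x + y)] and [nsq (x - y)] bounds the real part of [ip x y] by
    [nsq x + nsq y]; replacing [y] by [i y] bounds the imaginary part. The series is thus dominated
    by a summable one. *)
Lemma ip_sums (u v : nat -> H) (M N : R) :
  (forall n, \sum_(i < n) nsq (u i) <= M) -> (forall n, \sum_(i < n) nsq (v i) <= N) ->
  exists l, csums (fun n => ip (u n) (v n)) l.
Proof.
move=> hM hN.
have Reb x y : `|Re (ip x y)| <= nsq x + nsq y.
  have := nsq_ge0 (x + y); have := nsq_ge0 (x - y); rewrite nsqB nsqD.
  have := nsq_ge0 x; have := nsq_ge0 y.
  by rewrite ler_norml; move=> ? ? ? ?; apply/andP; split; lra.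
have Imb x y : `|Im (ip x y)| <= nsq x + nsq y.
  have -> : Im (ip x y) = Re (ip x ('i%C *: y)) by rewrite ipZr ReM /=; ring.
  apply: le_trans (Reb _ _) _; rewrite nsqZ /=.
  by rewrite expr0n expr1n add0r mul1r.
apply: (@csums_dominated _ _ (fun n => nsq (u n) + nsq (v n)) (M + N)) => n //.
by rewrite big_split lerD.
Qed.

Lemma l2_pos_bounded (f : l2) : exists M : R, forall n, \sum_(i < n) nsq (f (Posz i)) <= M.
Proof.
have [M hM] := l2_square_summable f; exists M => n; apply: le_trans (hM n).
by apply: ler_sum => i _; rewrite lerDl nsq_ge0.
Qed.

Lemma l2_neg_bounded (f : l2) : exists M : R, forall n, \sum_(i < n) nsq (f (Negz i)) <= M.
Proof.
have [M hM] := l2_square_summable f; exists M => n; apply: le_trans (hM n).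
by apply: ler_sum => i _; rewrite lerDr nsq_ge0.
Qed.

Lemma fold_ip_sums (f g : l2) : exists l, csums (fold_ip f g) l.
Proof.
have [M hM] := l2_pos_bounded f; have [N hN] := l2_pos_bounded g.
have [M' hM'] := l2_neg_bounded f; have [N' hN'] := l2_neg_bounded g.
have [p hp] := ip_sums (u := fun n => f (Posz n)) (v := fun n => g (Posz n)) hM hN.
have [q hq] := ip_sums (u := fun n => f (Negz n)) (v := fun n => g (Negz n)) hM' hN'.
by exists (p + q); exact: csumsD hp hq.
Qed.

Definition l2_ip (f g : l2) : R[i] := csum (fold_ip f g).

Lemma l2_ipP (f g : l2) : csums (fold_ip f g) (l2_ip f g).
Proof. exact/csumP/fold_ip_sums. Qed.

Lemma l2_ip_linl (a : R[i]) (f g h : l2) : l2_ip (a *: f + g) h = a * l2_ip f h + l2_ip g h.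
Proof.
apply: csum_eq.
have := csumsD (csumsZ a (l2_ipP f h)) (l2_ipP g h).
congr (csums _ _); apply: funext => n.
by rewrite /fold_ip !l2_linE !hs_linl mulrDr addrACA.
Qed.

Lemma l2_ip_sym (f g : l2) : l2_ip f g = conjc (l2_ip g f).
Proof.
apply: csum_eq; have := csumsJ (l2_ipP g f); congr (csums _ _); apply: funext => n.
by rewrite /fold_ip conjcD -!hs_sym.
Qed.

Lemma fold_ipxx f n : fold_ip f f n = (fold_nsq f n)%:C.
Proof. by rewrite /fold_ip !ipxx -rmorphD. Qed.

Definition l2_nsq (f : l2) : R := Re (l2_ip f f).

Lemma l2_nsq_cvg (f : l2) : (\sum_(i < n) fold_nsq f i @[n --> \oo] --> l2_nsq f)%classic.
Proof.
have [h _] := l2_ipP f f.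
rewrite (_ : (fun n => _) = fun n => \sum_(i < n) Re (fold_ip f f i)) //.
by apply: funext => n; apply: eq_bigr => i _; rewrite fold_ipxx.
Qed.

Lemma fold_nsq_sum_mono f :
  {homo (fun n => \sum_(i < n) fold_nsq f i) : m n / (m <= n)%N >-> m <= n}.
Proof.
apply: homo_leq => [x //|y x z|n]; first exact: le_trans.
by rewrite big_ord_recr /= lerDl fold_nsq_ge0.
Qed.

Lemma l2_nsq_ge (f : l2) n : \sum_(i < n) fold_nsq f i <= l2_nsq f.
Proof.
have h := @l2_nsq_cvg f.
have <- := cvg_lim (@norm_hausdorff _ _) h.
apply: (@nondecreasing_cvgn_le _ (fun n => \sum_(i < n) fold_nsq f i)).
  exact: fold_nsq_sum_mono.
by apply: cvgP h.
Qed.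

Lemma l2_nsq_le (f : l2) (M : R) :
  (forall n, \sum_(i < n) fold_nsq f i <= M) -> l2_nsq f <= M.
Proof.
move=> hM; have h := @l2_nsq_cvg f.
have <- := cvg_lim (@norm_hausdorff _ _) h.
apply: limr_le; first exact: cvgP h.
by apply: nearW.
Qed.

Lemma l2_ipxx (f : l2) : l2_ip f f = (l2_nsq f)%:C.
Proof.
apply: complex_ext => //=.
have [_ h] := l2_ipP f f; apply: (cvg_unique (@norm_hausdorff _ _) h).
rewrite (_ : (fun n => _) = fun=> 0); first exact: cvg_cst.
by apply: funext => n; rewrite big1 // => i _; rewrite fold_ipxx.
Qed.

Lemma l2_nsq_term (f : l2) z : nsq (f z) <= l2_nsq f.
Proof.
have h n : fold_nsq f n <= l2_nsq f.
  apply: le_trans (l2_nsq_ge f n.+1); rewrite big_ord_recr /= lerDr.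
  by apply: sumr_ge0 => i _; exact: fold_nsq_ge0.
case: z => n; apply: le_trans (h n); rewrite /fold_nsq ?lerDl ?lerDr; exact: nsq_ge0.
Qed.

Lemma l2_ip_pos (f : l2) : 0 <= l2_ip f f.
Proof. by rewrite l2_ipxx ler0c (le_trans _ (l2_nsq_term f 0)) ?nsq_ge0. Qed.

Lemma l2_ip_def (f : l2) : l2_ip f f = 0 -> f = 0.
Proof.
move=> h; apply: l2_ext => z; apply/nsq_eq0/le_anti; rewrite nsq_ge0 andbT.
by apply: le_trans (l2_nsq_term f z) _; rewrite /l2_nsq h.
Qed.

(** The limit is taken entrywise; the Cauchy bound passes to it on each finite window of indices,
    uniformly in the window, and this also shows that the limit is square-summable. *)
Lemma l2_complete (u : nat -> l2) :
  (forall e : R, 0 < e -> exists N : nat, forall m n : nat,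
     (N <= m)%N -> (N <= n)%N -> l2_ip (u m - u n) (u m - u n) < e%:C) ->
  exists l : l2, forall e : R, 0 < e -> exists N : nat, forall n : nat,
     (N <= n)%N -> l2_ip (u n - l) (u n - l) < e%:C.
Proof.
move=> cu.
have cu' (e : R) : 0 < e -> exists N, forall m n,
    (N <= m)%N -> (N <= n)%N -> l2_nsq (u m - u n) < e.
  by move=> /cu [N hN]; exists N => m n Nm Nn; rewrite -ltcR -l2_ipxx hN.
have pointwise z : exists lz, forall e : R, 0 < e ->
    exists N, forall n, (N <= n)%N -> nsq (u n z - lz) < e.
  have [|lz hz] := @hs_complete _ H (fun n => u n z).
    move=> e /cu' [N hN]; exists N => m n Nm Nn; rewrite ipxx ltcR.
    by apply: le_lt_trans (hN _ _ Nm Nn); rewrite -l2_subE l2_nsq_term.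
  by exists lz => e /hz [N hN]; exists N => n /hN; rewrite ipxx ltcR.
have [l hl] := choice pointwise.
have small K (e : R) : 0 < e -> exists N, forall n, (N <= n)%N ->
    \sum_(i < K) fold_nsq (l2_val (u n) - l) i < e.
  elim: K e => [|K IH] e e0; first by exists 0%N => n _; rewrite big_ord0.
  have e3 : 0 < e / 3 by rewrite divr_gt0.
  have [N1 h1] := IH _ e3.
  have [N2 h2] := hl (Posz K) _ e3; have [N3 h3] := hl (Negz K) _ e3.
  exists (maxn N1 (maxn N2 N3)) => n; rewrite !geq_max => /and3P[/h1 k1 /h2 k2 /h3 k3].
  rewrite big_ord_recr /=; move: k1 k2 k3.
  by rewrite [X in _ -> _ -> _ -> _ + X < _]fold_nsqB; lra.
have key (e : R) : 0 < e -> exists N, forall n, (N <= n)%N -> forall K,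
    \sum_(i < K) fold_nsq (l2_val (u n) - l) i <= 4 * e.
  move=> e0; have [N hN] := cu' _ e0; exists N => n Nn K.
  (* The intermediate index [m] depends on the window [K], but [N] does not. The factor 4 comes from
     applying [nsq (x + y) <= 2 * nsq x + 2 * nsq y] with both parts below [e]. *)
  have [N' hN'] := small K _ e0; pose m := maxn N N'.
  have k1 := hN' m (leq_maxr _ _).
  have k2 := le_lt_trans (l2_nsq_ge _ K) (hN n m Nn (leq_maxl _ _)).
  have -> : 4 * e = 2 * e + 2 * e by ring.
  have := lerD (ler_wpM2l (ler0n R 2) (ltW k2)) (ler_wpM2l (ler0n R 2) (ltW k1)).
  apply: le_trans; rewrite !big_distrr -big_split /=; apply: ler_sum => i _.
  have -> : l2_val (u n) - l = l2_val (u n - u m) + (l2_val (u m) - l).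
    by rewrite -(subrKA (l2_val (u m))).
  exact: fold_nsqD.
have lP : l \in l2_pred.
  have [N hN] := key _ ltr01.
  have d : l2_val (u N) - l \in l2_pred.
    by apply/asboolP; exists (4 * 1); exact: hN.
  have -> : l = l2_val (u N) + (-1) *: (l2_val (u N) - l).
    by rewrite scaleN1r opprB subrKC.
  have [[_ cD] cZ] := l2_submod_closed.
  by apply: cD; [exact: l2_valP | exact: cZ].
exists (L2 lP) => e e0.
(* The bound [4 * (e / 8)] is not strict; being [e / 2], it leaves room for the strict inequality
   required. *)
have e8 : 0 < e / 8 by rewrite divr_gt0.
have [N hN] := key _ e8; exists N => n /hN h.
rewrite l2_ipxx ltcR; apply: (@le_lt_trans _ _ (4 * (e / 8))); last lra.
by apply: l2_nsq_le => K; exact: h.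
Qed.

Definition l2_space : hilbertSpace R :=
  @HilbertSpace R l2 l2_ip l2_ip_linl l2_ip_sym l2_ip_pos l2_ip_def l2_complete.

Lemma l2_ip_split (f g : l2) (p q : R[i]) :
  csums (fun n => ip (f (Posz n)) (g (Posz n))) p ->
  csums (fun n => ip (f (Negz n)) (g (Negz n))) q -> l2_ip f g = p + q.
Proof. by move=> hp hq; apply: csum_eq; exact: csumsD hp hq. Qed.

End SquareSummable.


(** * Bounded partial sums when a first term is added or dropped *)

Section BoundedSums.
Variable R : realType.

Lemma bounded_sums_recl (b : nat -> R) :
  (exists M, forall n, \sum_(i < n) b i.+1 <= M) -> (forall n, 0 <= b n) ->
  exists M, forall n, \sum_(i < n) b i <= M.
Proof.
move=> [M hM] b0; exists (b 0 + M) => -[|n].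
  by rewrite big_ord0 addr_ge0 //; have := hM 0; rewrite big_ord0.
by rewrite big_ord_recl lerD2l; exact: hM.
Qed.

Lemma bounded_sums_behead (b : nat -> R) :
  (exists M, forall n, \sum_(i < n) b i <= M) -> (forall n, 0 <= b n) ->
  exists M, forall n, \sum_(i < n) b i.+1 <= M.
Proof.
move=> [M hM] b0; exists M => n; apply: le_trans (hM n.+1).
by rewrite big_ord_recl lerDr.
Qed.

End BoundedSums.

(** * The Schaeffer dilation of one contraction *)

Section Schaeffer.
Variables (R : realType) (H : hilbertSpace R).
Local Notation ip := (hs_inner H).
Local Notation K := (l2_space H).

Lemma l2_pred_split (f : int -> H) :
  (exists M : R, forall n, \sum_(i < n) nsq (f (Posz i)) <= M) ->
  (exists M : R, forall n, \sum_(i < n) nsq (f (Negz i)) <= M) ->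
  f \in @l2_pred R H.
Proof.
move=> [M hM] [N hN]; apply/asboolP; exists (M + N) => n.
by rewrite big_split lerD.
Qed.

Lemma l2_pos_tail (f : l2 H) : exists M : R, forall n, \sum_(i < n) nsq (f (Posz i.+1)) <= M.
Proof.
apply: (bounded_sums_behead (b := fun n => nsq (f (Posz n)))) => [|n]; last exact: nsq_ge0.
exact: l2_pos_bounded.
Qed.

Lemma l2_neg_tail (f : l2 H) : exists M : R, forall n, \sum_(i < n) nsq (f (Negz i.+1)) <= M.
Proof.
apply: (bounded_sums_behead (b := fun n => nsq (f (Negz n)))) => [|n]; last exact: nsq_ge0.
exact: l2_neg_bounded.
Qed.

(** * Diagonal operators with unimodular weights *)

Section Diagonal.

Lemma diag_l2P (w : int -> R[i]) (T : H -> H) (f : K) :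
  (forall z, w z * conjc (w z) = 1) -> contraction T ->
  (fun z => w z *: T (f z)) \in @l2_pred R H.
Proof.
move=> w1 cT; apply/asboolP; have := l2_square_summable f.
apply: square_summable_dom1 => n.
by rewrite /fold_nsq !nsqZ1 // lerD // contraction_nsq.
Qed.

(* Junk value [0] unless the weights are unimodular and [T] is a contraction. *)
Definition diag (w : int -> R[i]) (T : H -> H) (f : K) : K :=
  insubd (0 : l2 H) (fun z => w z *: T (f z)).

Variables (w : int -> R[i]) (T : H -> H).
Hypotheses (w1 : forall z, w z * conjc (w z) = 1) (cT : contraction T).

Lemma diagE f z : l2_val (diag w T f) z = w z *: T (l2_val f z).
Proof. by rewrite [l2_val _]insubdK //; exact: diag_l2P. Qed.

Lemma diag_lin : lin_op (diag w T).
Proof.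
move=> a f g; apply: l2_ext => z; rewrite l2_linE !diagE l2_linE.
by rewrite cT.1 scalerDr !scalerA mulrC.
Qed.

Lemma diag_contraction : contraction (diag w T).
Proof.
split=> [|f]; first exact: diag_lin.
rewrite !ipxx lecR; apply: l2_nsq_le => n; apply: le_trans (l2_nsq_ge f n).
apply: ler_sum => i _; rewrite /fold_nsq !diagE !nsqZ1 //.
by rewrite lerD // contraction_nsq.
Qed.

End Diagonal.

Lemma diag_adj (w : int -> R[i]) (T Ts : H -> H) :
  (forall z, w z * conjc (w z) = 1) -> contraction T -> is_adjoint T Ts ->
  is_adjoint (diag w T) (diag (fun z => conjc (w z)) Ts).
Proof.
move=> w1 cT aT f g; congr csum; apply: funext => n.
have cTs := adjoint_contraction aT cT.
have w1' z : conjc (w z) * conjc (conjc (w z)) = 1 by rewrite conjcK mulrC.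
by rewrite /fold_ip !diagE // !ipZl !ipZr !conjcK !aT.
Qed.

(** * The Schaeffer unitary and the copy of [H] at position 0 *)

Section OneOperator.
Variables (A As D Ds : H -> H).
Hypotheses (linA : lin_op A) (linAs : lin_op As) (lin_D : lin_op D) (linDs : lin_op Ds).
Hypotheses (aA : is_adjoint A As) (aD : is_adjoint D D) (aDs : is_adjoint Ds Ds).
Hypotheses (D_sq : forall x, D (D x) = x - As (A x))
  (Ds_sq : forall x, Ds (Ds x) = x - A (As x)).
Hypotheses (A_D : forall x, A (D x) = Ds (A x)) (As_Ds : forall x, As (Ds x) = D (As x)).

(** Entry [z] of the image is entry [z - 1] of [f], except that positions 0 and -1 are sent by the
    central block to positions 0 and 1. *)
Definition schaeffer_fun (f : int -> H) (z : int) : H :=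
  match z with
  | Posz 0 => A (f (Posz 0)) + Ds (f (Negz 0))
  | Posz 1 => D (f (Posz 0)) - As (f (Negz 0))
  | Posz n.+2 => f (Posz n.+1)
  | Negz n => f (Negz n.+1)
  end.

Definition schaeffer_adj_fun (f : int -> H) (z : int) : H :=
  match z with
  | Posz 0 => As (f (Posz 0)) + D (f (Posz 1))
  | Posz n.+1 => f (Posz n.+2)
  | Negz 0 => Ds (f (Posz 0)) - A (f (Posz 1))
  | Negz n.+1 => f (Negz n)
  end.

Lemma schaeffer_l2 (f : l2 H) : schaeffer_fun f \in @l2_pred R H.
Proof.
apply: l2_pred_split.
  apply: (bounded_sums_recl (b := fun n => nsq (schaeffer_fun f (Posz n)))) => [|n];
    last exact: nsq_ge0.
  apply: (bounded_sums_recl (b := fun n => nsq (schaeffer_fun f (Posz n.+1)))) => [|n];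
    last exact: nsq_ge0.
  exact: l2_pos_tail.
exact: l2_neg_tail.
Qed.

Lemma schaeffer_adj_l2 (f : l2 H) : schaeffer_adj_fun f \in @l2_pred R H.
Proof.
apply: l2_pred_split.
  apply: (bounded_sums_recl (b := fun n => nsq (schaeffer_adj_fun f (Posz n)))) => [|n];
    last exact: nsq_ge0.
  apply: (bounded_sums_behead (b := fun n => nsq (f (Posz n.+1)))) => [|n]; last exact: nsq_ge0.
  exact: l2_pos_tail.
apply: (bounded_sums_recl (b := fun n => nsq (schaeffer_adj_fun f (Negz n)))) => [|n];
  last exact: nsq_ge0.
exact: l2_neg_bounded f.
Qed.

Definition schaeffer (f : K) : K := L2 (schaeffer_l2 f).
Definition schaeffer_adj (f : K) : K := L2 (schaeffer_adj_l2 f).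

(** On the central block the diagonal terms add up to the identity by the formulas for the squares
    of [D] and [Ds], and the cross terms cancel by [As Ds = D As] and [A D = Ds A]. *)
Lemma schaefferK : cancel schaeffer schaeffer_adj.
Proof.
move=> f; apply: l2_ext => -[[|n]|[|n]] //=.
  rewrite (linD linAs) (linB lin_D) As_Ds D_sq /=.
  by rewrite addrCA addrAC !addrA addrK addrAC subrK.
rewrite (linD linDs) (linB linA) A_D Ds_sq /=.
by rewrite opprB addrC subrKA addrC subrK.
Qed.

Lemma schaeffer_adjK : cancel schaeffer_adj schaeffer.
Proof.
move=> f; apply: l2_ext => -[[|[|n]]|n] //=.
  rewrite (linD linA) (linB linDs) A_D Ds_sq /=.
  by rewrite addrC addrACA subrK addNr addr0.
rewrite (linD lin_D) (linB linAs) As_Ds D_sq /=.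
by rewrite opprB addrC subrKA addrC subrK.
Qed.

(** Removing positions 0 and 1 on the left, and 0 and -1 on the right, leaves the same two shifted
    series with sums [p] and [q]; what remains is the adjoint relation of the central blocks. *)
Lemma schaeffer_adjoint : is_adjoint schaeffer schaeffer_adj.
Proof.
move=> f g.
have [Mf hMf] := l2_pos_tail f.
have [Mg hMg] := bounded_sums_behead (b := fun n => nsq (l2_val g (Posz n.+1)))
  (l2_pos_tail g) (fun n => nsq_ge0 _).
have [Nf hNf] := l2_neg_tail f.
have [Ng hNg] := l2_neg_bounded g.
have [p hp] := ip_sums (u := fun n => l2_val f (Posz n.+1))
  (v := fun n => l2_val g (Posz n.+2)) hMf hMg.
have [q hq] := ip_sums (u := fun n => l2_val f (Negz n.+1))
  (v := fun n => l2_val g (Negz n)) hNf hNg.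
rewrite [LHS](l2_ip_split (f := schaeffer f) (csums_recl (csums_recl hp)) hq).
rewrite [RHS](l2_ip_split (g := schaeffer_adj g) (csums_recl hp) (csums_recl hq)) /=.
rewrite !ipDl !ipDr !ipNl !ipNr aA (adjoint_sym aA) aD aDs.
ring.
Qed.

(** The shift part requires [w (z - 1) = c * w z], and [w 0 = 1] then forces the power [-z] of [c];
    negative powers are written with [conjc c]. The same weights fit the central block. *)
Lemma schaeffer_diag (c : R[i]) (T : H -> H) : c * conjc c = 1 -> contraction T ->
  (forall x, D (T x) = T (D x)) -> (forall x, Ds (T x) = T (Ds x)) ->
  (forall x, A (T x) = c *: T (A x)) -> (forall x, As (T x) = conjc c *: T (As x)) ->
  let w z := match z with Posz n => conjc c ^+ n | Negz n => c ^+ n.+1 end in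
  forall f, schaeffer (diag w T f) = c *: diag w T (schaeffer f).
Proof.
move=> c1 cT DT DsT AT AsT w f.
have w1 z : w z * conjc (w z) = 1.
  by case: z => n; apply: expr_mulJ => //; rewrite conjcK mulrC.
apply: l2_ext => z; rewrite -[c *: _]addr0 l2_linE addr0 diagE //.
case: z => [[|[|n]]|n] /=; rewrite !diagE //=.
- by rewrite !expr0 expr1 !scale1r (linZ linDs) AT DsT (linD cT.1) scalerDr.
- rewrite !expr0 !expr1 !scale1r (linZ linAs) AsT DT scalerA c1 scale1r scalerA c1 scale1r.
  by rewrite (linB cT.1).
- by rewrite scalerA [_ ^+ n.+2]exprS mulrA c1 mul1r.
- by rewrite scalerA -exprS.
Qed.

Lemma embed_l2 (x : H) : (fun z : int => if z == 0 then x else 0) \in @l2_pred R H.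
Proof.
apply: l2_pred_split.
  apply: (bounded_sums_recl (b := fun n => nsq (if Posz n == 0 then x else 0))) => [|n];
    last exact: nsq_ge0.
  by exists 0 => n; rewrite big1 // => i _; rewrite nsq0.
by exists 0 => n; rewrite big1 // => i _; rewrite nsq0.
Qed.

Definition embed (x : H) : K := L2 (embed_l2 x).

Lemma l2_ip_embed (f : K) y : hs_inner K f (embed y) = ip (l2_val f 0) y.
Proof.
rewrite -[RHS]addr0 -[X in _ = X + _]addr0.
apply: (l2_ip_split (g := embed y)).
  apply: (csums_recl (phi := fun n => ip (l2_val f (Posz n)) (l2_val (embed y) (Posz n)))).
  rewrite (_ : (fun n => _) = fun=> 0); first exact: csums0.
  by apply: funext => n; rewrite /= ip0r.
rewrite (_ : (fun n => _) = fun=> 0); first exact: csums0.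
by apply: funext => n; rewrite /= ip0r.
Qed.

Lemma embed_isometric : isometric_embedding embed.
Proof.
split=> [a x y|x y]; last by rewrite l2_ip_embed.
by apply: l2_ext => z; rewrite l2_linE /=; case: eqP => // _; rewrite scaler0 addr0.
Qed.

Lemma diag_embed w T x : (forall z, w z * conjc (w z) = 1) -> w 0 = 1 ->
  contraction T -> diag w T (embed x) = embed (T x).
Proof.
move=> w1 w0 cT; apply: l2_ext => z; rewrite diagE //=.
by case: eqP => [->|_]; [rewrite w0 scale1r | rewrite (lin0 cT.1) scaler0].
Qed.

(** Starting from an embedded vector, positive powers keep all negative entries 0, so [Ds]
    contributes nothing and entry 0 evolves by [A] alone. Negative powers reduce to these by taking
    adjoints. *)
Lemma schaeffer_dilation (m : int) x y :
  hs_inner K (zpow schaeffer schaeffer_adj m (embed x)) (embed y) = ip (zpow A As m x) y.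
Proof.
have pos n u v : hs_inner K (iter n schaeffer (embed u)) (embed v) = ip (iter n A u) v.
  rewrite l2_ip_embed; congr (ip _ v).
  suff [] : l2_val (iter n schaeffer (embed u)) (Posz 0) = iter n A u /\
    forall j, l2_val (iter n schaeffer (embed u)) (Negz j) = 0 by [].
  elim: n => [|n [IH1 IH2]] //=; split=> [|j]; last exact: IH2.
  by rewrite IH1 IH2 (lin0 linDs) addr0.
case: m => n; first exact: pos.
rewrite (iter_adj n.+1 (adjoint_sym schaeffer_adjoint)) hs_sym pos -hs_sym.
by rewrite (iter_adj n.+1 (adjoint_sym aA)).
Qed.

End OneOperator.
End Schaeffer.

(** * Dilations of q-commuting systems *)

Section Systems.
Variables (R : realType) (k : nat) (c : 'I_k -> 'I_k -> R[i]).

(** The relations cover all ordered pairs of distinct indices, so that any index can be the next one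
    to dilate. *)
Definition q_system (H : hilbertSpace R) (T Ts : 'I_k -> H -> H) : Prop :=
  [/\ forall a, contraction (T a), forall a, is_adjoint (T a) (Ts a),
      forall a b, a != b -> forall x, T a (T b x) = c a b *: T b (T a x) &
      forall a b, a != b -> forall x, T a (Ts b x) = conjc (c a b) *: Ts b (T a x)].

(** The compression is tested against the range of [V], a form that composes along successive
    embeddings. *)
Definition dilates (H K : hilbertSpace R) (V : H -> K)
    (T Ts : 'I_k -> H -> H) (U Us : 'I_k -> K -> K) : Prop :=
  isometric_embedding V /\ forall m x y,
    hs_inner K (zprod U Us m (V x)) (V y) = hs_inner H (zprod T Ts m x) y.

Lemma dilates_trans (H K L : hilbertSpace R) (V : H -> K) (W : K -> L) T Ts U Us X Xs :
  dilates V T Ts U Us -> dilates W U Us X Xs -> dilates (W \o V) T Ts X Xs.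
Proof.
move=> [[V1 V2] V3] [[W1 W2] W3]; split; first split=> [a x y|x y] /=.
- by rewrite V1 W1.
- by rewrite W2 V2.
by move=> m x y /=; rewrite W3 V3.
Qed.

Lemma zpow_adj (H : hilbertSpace R) (S Ss : H -> H) m : is_adjoint S Ss ->
  is_adjoint (zpow S Ss m) (zpow Ss S m).
Proof.
by move=> aS; case: m => n; apply: iter_adj => //; exact: adjoint_sym.
Qed.

Lemma zpow_intertwine (H K : hilbertSpace R) (V : H -> K) (T Ts : H -> H) (U Us : K -> K) m :
  (forall x, U (V x) = V (T x)) -> (forall x, Us (V x) = V (Ts x)) ->
  forall x, zpow U Us m (V x) = V (zpow T Ts m x).
Proof.
move=> UV UsV.
have it (X : K -> K) (Y : H -> H) n : (forall x, X (V x) = V (Y x)) ->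
    forall x, iter n X (V x) = V (iter n Y x).
  by move=> XV; elim: n => [|n IH] x //=; rewrite IH XV.
by case: m => n x; exact: it.
Qed.

(* Only the [p]-th factor is dilated; the other factors and their adjoints
   leave the range of [V] invariant. *)
Lemma dilates_one (H K : hilbertSpace R) (V : H -> K) T Ts U Us (p : 'I_k) :
  isometric_embedding V -> (forall a, is_adjoint (T a) (Ts a)) ->
  (forall a, is_adjoint (U a) (Us a)) ->
  (forall a, a != p -> forall x, U a (V x) = V (T a x)) ->
  (forall a, a != p -> forall x, Us a (V x) = V (Ts a x)) ->
  (forall m x y, hs_inner K (zpow (U p) (Us p) m (V x)) (V y) =
                 hs_inner H (zpow (T p) (Ts p) m x) y) ->
  dilates V T Ts U Us.
Proof.
move=> isoV aT aU UV UsV Up; split=> // m; rewrite /zprod.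
have inv s : p \notin s -> forall x,
    foldr (fun i acc => zpow (U i) (Us i) (m i) \o acc) id s (V x) =
    V (foldr (fun i acc => zpow (T i) (Ts i) (m i) \o acc) id s x).
  elim: s => [//|a s IH]; rewrite inE negb_or => /andP[pa ps] x /=.
  by rewrite IH // (zpow_intertwine (T := T a) (Ts := Ts a)) // => z;
     [apply: UV | apply: UsV]; rewrite eq_sym.
elim: (enum 'I_k) (enum_uniq 'I_k) => [_ x y|a s IH /= /andP[as_ us] x y] /=.
  by have [_ ->] := isoV.
(* If the head is [p], the tail avoids [p] and passes through [V]. Otherwise the head moves, as its
   adjoint, to the other side of the inner product, where it passes through [V]. *)
have [ap|ap] := eqVneq a p.
  by subst a; rewrite inv // Up.
rewrite (zpow_adj _ (aU a)) (zpow_intertwine (T := Ts a) (Ts := T a)); last 2 first.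
- exact: UsV.
- exact: UV.
by rewrite IH // (zpow_adj _ (aT a)).
Qed.

(** Conjugating [U S = d S U] by the inverse [Us] gives [S Us = d Us S], and the adjoint of this is
    the relation between [U] and [Ss]. *)
Lemma unitary_adjoint_comm (K : hilbertSpace R) (U Us S Ss : K -> K) (d : R[i]) :
  is_adjoint U Us -> cancel U Us -> cancel Us U -> is_adjoint S Ss ->
  d * conjc d = 1 -> (forall x, U (S x) = d *: S (U x)) ->
  (forall x, U (Ss x) = conjc d *: Ss (U x)) /\ (forall x, S (Us x) = d *: Us (S x)).
Proof.
move=> aU UK UsK aS d1 US.
have lUs := adjoint_lin (adjoint_sym aU).
have h x : S (Us x) = d *: Us (S x).
  by rewrite -[LHS]UK US UsK (linZ lUs).
split=> // x; apply: ip_ext => z.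
by rewrite aU (adjoint_sym aS) h ipZr ipZl (adjoint_sym aS) aU.
Qed.

(** * Making the operators unitary one after the other *)

Section Step.
Hypotheses (c1 : forall a b, a != b -> c a b * conjc (c a b) = 1)
  (cJ : forall a b, a != b -> c b a = conjc (c a b)).

(** The last clause allows iteration: a unitary [T a] yields a diagonal operator that is again
    unitary, its weights being unimodular. *)
Lemma dilate_one_unitary (H : hilbertSpace R) (T Ts : 'I_k -> H -> H) (p : 'I_k) :
  q_system T Ts ->
  exists (K : hilbertSpace R) (V : H -> K) (U Us : 'I_k -> K -> K),
    [/\ q_system U Us, dilates V T Ts U Us,
        cancel (U p) (Us p) /\ cancel (Us p) (U p) &
        forall a, cancel (T a) (Ts a) -> cancel (Ts a) (T a) ->
          cancel (U a) (Us a) /\ cancel (Us a) (U a)].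
Proof.
move=> [cT aT TT TTs].
pose K := l2_space H.
pose A := T p; pose As := Ts p.
have cA : contraction A := cT p; have aA : is_adjoint A As := aT p.
have cTs a : contraction (Ts a) := adjoint_contraction (aT a) (cT a).
have cAs : contraction As := cTs p.
have cB : contraction (As \o A) by exact: contraction_comp.
have cBs : contraction (A \o As) by exact: contraction_comp.
have aB : is_adjoint (As \o A) (As \o A).
  by move=> x y /=; rewrite (adjoint_sym aA) aA.
have aBs : is_adjoint (A \o As) (A \o As).
  by move=> x y /=; rewrite aA (adjoint_sym aA).
pose D := defect (As \o A); pose Ds := defect (A \o As).
have lD : lin_op D := defect_lin cB; have lDs : lin_op Ds := defect_lin cBs.
have aD : is_adjoint D D := defect_adj cB aB.
have aDs : is_adjoint Ds Ds := defect_adj cBs aBs.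
have D_sq x : D (D x) = x - As (A x) := defect_sq cB x.
have Ds_sq x : Ds (Ds x) = x - A (As x) := defect_sq cBs x.
have A_D x : A (D x) = Ds (A x) by exact: (defect_comm cB cBs cA).
have As_Ds x : As (Ds x) = D (As x) by exact: (defect_comm cBs cB cAs).
pose S : K -> K := schaeffer A As D Ds; pose Ss : K -> K := schaeffer_adj A As D Ds.
have aS : is_adjoint S Ss := schaeffer_adjoint aA aD aDs.
have SK : cancel S Ss := schaefferK cA.1 cAs.1 lD lDs D_sq Ds_sq A_D As_Ds.
have SsK : cancel Ss S := schaeffer_adjK cA.1 cAs.1 lD lDs D_sq Ds_sq A_D As_Ds.
(* The value 1 at [a = p] is a default that keeps the weights unimodular for every index. *)
pose w a (z : int) : R[i] := if a == p then 1 else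
  match z with Posz n => conjc (c p a) ^+ n | Negz n => c p a ^+ n.+1 end.
have w1 a z : w a z * conjc (w a z) = 1.
  rewrite /w; case: eqP => [_|ap]; first by rewrite mul1r conjc1.
  have pa : p != a by rewrite eq_sym; apply/eqP.
  by case: z => n; apply: expr_mulJ; last exact: c1; rewrite conjcK mulrC c1.
have w1' a z : conjc (w a z) * conjc (conjc (w a z)) = 1 by rewrite conjcK mulrC.
have w0 a : w a 0 = 1 by rewrite /w; case: eqP.
pose U a : K -> K := if a == p then S else diag (w a) (T a).
pose Us a : K -> K := if a == p then Ss else diag (fun z => conjc (w a z)) (Ts a).
have Up : U p = S by rewrite /U eqxx.
have Usp : Us p = Ss by rewrite /Us eqxx.
have Un a : a != p -> U a = diag (w a) (T a) by rewrite /U => /negPf ->.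
have Usn a : a != p -> Us a = diag (fun z => conjc (w a z)) (Ts a).
  by rewrite /Us => /negPf ->.
have aU a : is_adjoint (U a) (Us a).
  rewrite /U /Us; case: eqP => // _; exact: diag_adj.
have cU a : contraction (U a).
  rewrite /U; case: eqP => [_|_]; last exact: diag_contraction.
  split=> [|x]; [exact: adjoint_lin aS | by rewrite aS SK].
have lUs a : lin_op (Us a) := adjoint_lin (adjoint_sym (aU a)).
have SU a : a != p -> forall x, S (U a x) = c p a *: U a (S x).
  move=> ap x; have pa : p != a by rewrite eq_sym.
  have AT y : A (T a y) = c p a *: T a (A y) by exact: TT.
  (* The adjoint relation is taken for the pair [(a, p)], so that the adjoint falls on [A]. *)
  have AsT y : As (T a y) = conjc (c p a) *: T a (As y).
    by rewrite TTs // (cJ pa) conjcK scalerA mulrC c1 // scale1r.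
  (* The phases picked up from [A] and [As] are conjugate and cancel, so [T a] commutes with both
     products and hence with their defects. *)
  have h1 : (As \o A) \o T a =1 T a \o (As \o A).
    by move=> y /=; rewrite AT (linZ cAs.1) AsT scalerA c1 // scale1r.
  have h2 : (A \o As) \o T a =1 T a \o (A \o As).
    by move=> y /=; rewrite AsT (linZ cA.1) AT scalerA mulrC c1 // scale1r.
  have := schaeffer_diag (A := A) (As := As) (D := D) (Ds := Ds) cAs.1 lDs (c1 pa)
    (cT a) (fun y => esym (defect_comm cB cB (cT a) (fun z => esym (h1 z)) y))
    (fun y => esym (defect_comm cBs cBs (cT a) (fun z => esym (h2 z)) y)) AT AsT x.
  by rewrite Un // /w (negPf ap).
(* A pair containing [p] is settled by unitarity of [S]; for two diagonal operators the relation
   holds entrywise, as the weights are scalars. *)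
have comm a b : a != b -> (forall x, U a (U b x) = c a b *: U b (U a x)) /\
    (forall x, U a (Us b x) = conjc (c a b) *: Us b (U a x)).
  move=> ab; have [ap|ap] := eqVneq a p.
    subst a; rewrite !Up; have bp : b != p by rewrite eq_sym.
    have [h _] := unitary_adjoint_comm aS SK SsK (aU b) (c1 ab) (SU b bp).
    by split=> // x; exact: SU.
  have [bp|bp] := eqVneq b p.
    subst b; rewrite !Up !Usp; have pa : p != a by rewrite eq_sym.
    have [_ h] := unitary_adjoint_comm aS SK SsK (aU a) (c1 pa) (SU a ap).
    rewrite (cJ pa) conjcK; split=> // x.
    by rewrite SU // scalerA mulrC c1 // scale1r.
  rewrite !Un // Usn //; split=> x; apply: l2_ext => z.
    rewrite -[c a b *: _]addr0 l2_linE addr0 !diagE // (linZ (cT a).1) (linZ (cT b).1).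
    by rewrite TT // !scalerA; congr (_ *: _); ring.
  rewrite -[conjc _ *: _]addr0 l2_linE addr0 !diagE // (linZ (cT a).1) (linZ (cTs b).1).
  by rewrite TTs // !scalerA; congr (_ *: _); ring.
exists K, (@embed R H), U, Us; split.
- split=> // a b ab x; [exact: (comm a b ab).1 | exact: (comm a b ab).2].
- apply: (dilates_one (p := p)) => //.
  + exact: embed_isometric.
  + by move=> a ap x; rewrite Un // diag_embed.
  + by move=> a ap x; rewrite Usn // diag_embed // w0 conjc1.
  + by rewrite Up Usp => m x y; exact: schaeffer_dilation.
- by rewrite Up Usp.
move=> a TK TsK; have [->|ap] := eqVneq a p; first by rewrite Up Usp.
rewrite Un // Usn //; split=> x; apply: l2_ext => z; rewrite !diagE //.
  by rewrite (linZ (cTs a).1) scalerA mulrC w1 scale1r TK.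
by rewrite (linZ (cT a).1) scalerA w1 scale1r TsK.
Qed.

Lemma q_unitary_dilation (H : hilbertSpace R) (T Ts : 'I_k -> H -> H) :
  q_system T Ts ->
  exists (K : hilbertSpace R) (V : H -> K) (U Us : 'I_k -> K -> K),
    [/\ q_system U Us, dilates V T Ts U Us &
        forall a, cancel (U a) (Us a) /\ cancel (Us a) (U a)].
Proof.
move=> sT.
(* The induction is on the number [n] of leading indices already made unitary; it starts from [H]
   itself, and once [n] reaches [k] the step changes nothing. *)
have [n hn] : exists n, (k <= n)%N by exists k.
suff [K [V [U [Us [sU dU uU]]]]] : exists (K : hilbertSpace R) (V : H -> K) (U Us : 'I_k -> K -> K),
    [/\ q_system U Us, dilates V T Ts U Us &
        forall a : 'I_k, (a < n)%N -> cancel (U a) (Us a) /\ cancel (Us a) (U a)].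
  by exists K, V, U, Us; split=> // a; apply: uU; exact: leq_trans (ltn_ord a) hn.
elim: n {hn} => [|n [K [V [U [Us [sU dU uU]]]]]].
  by exists H, id, T, Ts; split.
have [nk|kn] := ltnP n k; last first.
  exists K, V, U, Us; split=> // a _; apply: uU; exact: leq_trans (ltn_ord a) kn.
have [L [W [X [Xs [sX dX pX uX]]]]] := dilate_one_unitary (Ordinal nk) sU.
exists L, (W \o V), X, Xs; split=> //; first exact: dilates_trans dU dX.
move=> a; rewrite ltnS leq_eqVlt => /orP[/eqP an|an].
  by have -> : a = Ordinal nk by apply: val_inj.
by have [h1 h2] := uU a an; exact: uX.
Qed.

End Step.
End Systems.

Theorem theorem3p5 (R : realType) (H : hilbertSpace R) (k : nat)
  (T Tstar : 'I_k -> H -> H) (q : 'I_k -> 'I_k -> R[i]) :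
  (forall i, contraction (T i)) ->
  (forall i, is_adjoint (T i) (Tstar i)) ->
  (forall i j : 'I_k, (i < j)%N -> `|q i j| = 1) ->
  (forall i j : 'I_k, (i < j)%N -> forall x : H,
      T i (T j x) = q i j *: T j (T i x)) ->
  (forall i j : 'I_k, (i < j)%N -> forall x : H,
      T i (Tstar j x) = (q i j)^* *: Tstar j (T i x)) ->
  exists (K : hilbertSpace R) (V : H -> K)
         (U Uinv : 'I_k -> K -> K) (Q Qinv : 'I_k -> 'I_k -> K -> K),
    isometric_embedding V /\
        (forall i, unitary (U i) (Uinv i)) /\
        (forall i j : 'I_k, (i < j)%N -> unitary (Q i j) (Qinv i j)) /\
        (forall i j i' j' : 'I_k, (i < j)%N -> (i' < j')%N -> forall x : K,
            Q i j (Q i' j' x) = Q i' j' (Q i j x)) /\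
        (forall i j : 'I_k, (i < j)%N -> forall x : K,
            U i (U j x) = Q i j (U j (U i x))) /\
        (forall i j m : 'I_k, (i < j)%N -> forall x : K,
            Q i j (U m x) = U m (Q i j x)) /\
        (forall (m : 'I_k -> int) (x : H),
            proj_eq V (zprod U Uinv m (V x)) (zprod T Tstar m x)) /\
        (* Q_ij = q_ij I (+) Qtilde_ij with Qtilde_ij unitary on H^perp *)
        (forall i j : 'I_k, (i < j)%N ->
          (forall x : H, Q i j (V x) = q i j *: V x) /\
          (forall z : K, (forall y : H, hs_inner K z (V y) = 0) ->
             (forall y : H, hs_inner K (Q i j z) (V y) = 0) /\
             exists w : K, (forall y : H, hs_inner K w (V y) = 0) /\ Q i j w = z)).
Proof.
move=> cT aT q1 TT TTs.
(* The coefficients are extended to all ordered pairs: reversing a pair conjugates the coefficient,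
   and the diagonal gets the value 1. *)
pose c (a b : 'I_k) : R[i] :=
  if (a < b)%N then q a b else if (b < a)%N then conjc (q b a) else 1.
have cE (a b : 'I_k) : (a < b)%N -> c a b = q a b by rewrite /c => ->.
have cE' (a b : 'I_k) : (b < a)%N -> c a b = conjc (q b a).
  by move=> ba; rewrite /c ltnNge ltnW //= ba.
have q1' (a b : 'I_k) : (a < b)%N -> q a b * conjc (q a b) = 1 by move=> ab; exact/norm1_mulJ/q1.
have c1 a b : a != b -> c a b * conjc (c a b) = 1.
  rewrite neq_ltn => /orP[ab|ba]; first by rewrite cE ?q1'.
  by rewrite cE' // conjcK mulrC q1'.
have cJ a b : a != b -> c b a = conjc (c a b).
  rewrite neq_ltn => /orP[ab|ba]; first by rewrite cE' // cE.
  by rewrite cE // cE' // conjcK.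
have sT : q_system c T Tstar.
  split=> // a b; rewrite neq_ltn => /orP[ab|ba] x.
  - by rewrite cE // TT.
  - by rewrite cE' // (TT _ _ ba) scalerA mulrC q1' // scale1r.
  - by rewrite cE // TTs.
  (* For [b < a] the relation is the adjoint of the given one for the pair [(b, a)]. *)
  rewrite cE' // conjcK; apply: ip_ext => z.
  by rewrite aT (adjoint_sym (aT b)) (TTs _ _ ba) ipZr ipZl conjcK (adjoint_sym (aT b)) aT.
have [K [V [U [Us [[cU aU UU _] [isoV dU] uU]]]]] := q_unitary_dilation c1 cJ sT.
(* Each [Q i j] is a scalar operator, so it commutes with every linear operator and preserves both
   the range of [V] and its orthogonal complement; the inverse of [U i] is its adjoint. *)
exists K, V, U, Us, (fun i j x => q i j *: x), (fun i j x => conjc (q i j) *: x).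
split=> //; split.
  move=> i; have [UK UsK] := uU i; split=> //; first exact: (cU i).1.
  by move=> x y; rewrite aU UK.
split.
  move=> i j ij; split=> [a x y|x y|x|x].
  - by rewrite scalerDr !scalerA mulrC.
  - by rewrite ipZl ipZr mulrA q1' // mul1r.
  - by rewrite scalerA mulrC q1' // scale1r.
  - by rewrite scalerA q1' // scale1r.
split; first by move=> i j i' j' _ _ x; rewrite !scalerA mulrC.
split; first by move=> i j ij x; rewrite UU ?cE // neq_ltn ij.
split; first by move=> i j m _ x; rewrite (linZ (cU m).1).
split.
  by move=> m x y; rewrite ipBl dU isoV.2 subrr.
move=> i j ij; split=> // z zV; split=> [y|]; first by rewrite ipZl zV mulr0.
(* The preimage under a unimodular scalar is multiplication by its conjugate, which stays in the
   orthogonal complement. *)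
exists (conjc (q i j) *: z); split=> [y|]; first by rewrite ipZl zV mulr0.
by rewrite scalerA q1' // scale1r.
Qed.
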